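(* Let $\Gamma$ be a tree on the vertex set $[n]$. Then the set of coset splines $\{\bar f_w^B\mid w\in S_n,\ B\subseteq E(\Gamma)\}$ generates $\mathcal{M}_\Gamma$ as a $\mathbb{C}[t_\bullet]$-module (for either the left or the right module structure). Moreover, the constant and linear coset splines, together with either $\{\bar t_i\mid i\in[n]\}$ or $\{\bar x_i\mid i\in[n]\}$, generate $\mathcal{M}_\Gamma$ as a ring (that is, as a $\mathbb{C}$-algebra).
   Context: $[n]=\{1,\dots,n\}$; an edge $(i,j)$ (written with $i<j$) of a graph on $[n]$ is identified with the transposition $(i,j)\in S_n$. Write $\mathbb{C}[t_\bullet]=\mathbb{C}[t_1,\dots,t_n]$; $w\in S_n$ acts on it by $(wf)(t_1,\dots,t_n)=f(t_{w(1)},\dots,t_{w(n)})$. Ring of splines: $\mathcal{M}_\Gamma$ is the set of functions $\bar\rho\colon S_n\to\mathbb{C}[t_\bullet]$ such that $\bar\rho(w)-\bar\rho(w(i,j))\in\langle t_{w(i)}-t_{w(j)}\rangle$ for all $w\in S_n$ and all $(i,j)\in E(\Gamma)$, with pointwise addition and multiplication, graded by polynomial degree (linear means homogeneous of degree 1). The dot action of $S_n$ is $(w\cdot\bar\rho)(v)=w\,\bar\rho(w^{-1}v)$. Let $\bar t_i,\bar x_i\in\mathcal{M}_\Gamma$ be $\bar t_i(w)=t_i$, $\bar x_i(w)=t_{w(i)}$. The left $\mathbb{C}[t_\bullet]$-module structure on $\mathcal{M}_\Gamma$ is $f.\bar\rho=f(\bar t_1,\dots,\bar t_n)\bar\rho$,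 and the right one is $f.\bar\rho=f(\bar x_1,\dots,\bar x_n)\bar\rho$. Coset splines: for a tree $\Gamma$ with edge set $E$ and $B\subseteq E$, let $\langle B\rangle\le S_n$ be the subgroup generated by the transpositions in $B$ (with $\langle\emptyset\rangle=\{e\}$), and define $\bar f_e^B(w)=\prod_{(i,j)\in E\setminus B}(t_{w(i)}-t_{w(j)})$ if $w\in\langle B\rangle$ and $\bar f_e^B(w)=0$ otherwise (empty products are $1$). For $w\in S_n$ put $\bar f_w^B=w\cdot\bar f_e^B$. The coset spline $\bar f_w^B$ is homogeneous of degree $|E\setminus B|$. *)

(* Defs.v *)
From mathcomp Require Import all_boot all_order all_algebra all_fingroup.
From mathcomp Require Export mpoly complex reals.

Set Implicit Arguments.
Unset Strict Implicit.
Unset Printing Implicit Defensive.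

Import GRing.Theory.
Local Open Scope ring_scope.

Section Graphs.

Variable T : finType.
Implicit Type e : rel T.

Definition is_simple_graph e := ssrbool.symmetric e /\ irreflexive e.

Definition is_connected e := (0 < #|T|)%N /\ forall x y, connect e x y.

(* Cycles have at least three vertices: [ucycle e [:: x; y]] holds for every
   edge xy. *)
Definition is_acyclic e := forall c : seq T, (2 < size c)%N -> ~ ucycle e c.

Definition is_tree e := [/\ is_simple_graph e, is_connected e & is_acyclic e].

End Graphs.

(* The vertex set [n] is 'I_n; an edge is listed once, as (i, j) with i < j. *)
Definition edges n (e : rel 'I_n) : {set 'I_n * 'I_n} :=
  [set p : 'I_n * 'I_n | (p.1 < p.2)%N && e p.1 p.2].

(* The functions from S_n to K[t_1, ..., t_n], with their pointwise ring and
   K-vector space structures. *)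
Notation polyfun K n := {ffun 'S_n -> {mpoly K[n]}}.

Section Splines.

Variables (K : fieldType) (n : nat).
Implicit Types (e : rel 'I_n) (B : {set 'I_n * 'I_n}) (v w : 'S_n).
Implicit Types (f : {mpoly K[n]}) (rho sigma : polyfun K n).
Implicit Types (gen P : polyfun K n -> Prop).

(* In MathComp (s * t) x = t (s x), whereas products in S_n are read here as
   composition of functions, right factor first: w (i,j) is [tperm i j * w] and
   w^-1 v is [v * w^-1]. *)

Definition spline e rho : Prop :=
  forall w (i j : 'I_n), (i, j) \in edges e ->
    exists q : {mpoly K[n]},
      rho w - rho (tperm i j * w)%g = q * ('X_(w i) - 'X_(w j)).

(* [msym w f] is f(t_{w(1)}, ..., t_{w(n)}). *)
Definition dot_action w rho : polyfun K n :=
  [ffun v => msym w (rho (v * w^-1)%g)].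

Definition spline_t (i : 'I_n) : polyfun K n := [ffun w : 'S_n => 'X_i].

Definition spline_x (i : 'I_n) : polyfun K n := [ffun w : 'S_n => 'X_(w i)].

(* f(a_1, ..., a_n) computed in the ring of functions; [mmap] does not apply
   since {ffun _ -> _} is only registered as a pzRingType. *)
Definition eval_at (a : 'I_n -> polyfun K n) f : polyfun K n :=
  \sum_(m <- msupp f) f@_m *: \prod_(i < n) a i ^+ m i.

Definition left_action f rho : polyfun K n := eval_at spline_t f * rho.

Definition right_action f rho : polyfun K n := eval_at spline_x f * rho.

Definition edge_group B : {set 'S_n} := <<[set tperm p.1 p.2 | p in B]>>%g.

Definition coset_spline_e e B : polyfun K n :=
  [ffun w => if w \in edge_group B
             then \prod_(p in edges e :\: B) ('X_(w p.1) - 'X_(w p.2))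
             else 0].

Definition coset_spline e B w : polyfun K n :=
  dot_action w (coset_spline_e e B).

Definition is_coset_spline e sigma : Prop :=
  exists w B, B \subset edges e /\ sigma = coset_spline e B w.

Definition homogeneous (d : nat) rho : Prop := forall w, rho w \is d.-homog.

Definition constant_or_linear_coset_spline e sigma : Prop :=
  is_coset_spline e sigma /\ (homogeneous 0 sigma \/ homogeneous 1 sigma).

Definition submodule (act : {mpoly K[n]} -> polyfun K n -> polyfun K n) P : Prop :=
  [/\ P 0,
      forall rho sigma, P rho -> P sigma -> P (rho + sigma)
    & forall f rho, P rho -> P (act f rho)].

Definition module_span act gen rho : Prop :=
  forall P, submodule act P -> (forall sigma, gen sigma -> P sigma) -> P rho.

Definition subalgebra P : Prop :=
  [/\ P 1,
      forall rho sigma, P rho -> P sigma -> P (rho + sigma),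
      forall rho sigma, P rho -> P sigma -> P (rho * sigma)
    & forall (c : K) rho, P rho -> P (c *: rho)].

Definition algebra_span gen rho : Prop :=
  forall P, subalgebra P -> (forall sigma, gen sigma -> P sigma) -> P rho.

End Splines.

(* Main.v *)
Require Import Defs.
From mathcomp Require Import all_boot all_order all_algebra all_fingroup.

Set Implicit Arguments.
Unset Strict Implicit.
Unset Printing Implicit Defensive.

Import GRing.Theory.
Local Open Scope ring_scope.

(* Right module.  Put k w = w^-1 rho(w).  The spline condition becomes
   k w = k (w(i,j)) modulo x_i - x_j for every edge p = (i, j).  As the graph
   is a tree, the fundamental cut of p defines a substitution pi_p of the
   variables that kills root p = x_i - x_j and fixes the root of every other
   edge.  Write k = pi_p k + k' root p: pi_p k is constant on the pairs w,
   w(i,j), and both pi_p k and k' still satisfy the conditions for the other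
   edges.  After all edges have been treated, k is a sum over sets B of edges
   of functions h * prod_{p notin B} root p with h constant on the cosets
   w<B>, and each of these is a combination of coset splines.

   Left module.  On the coset w<B>, the linear form x_i - t_{w(i)} is a
   combination of the roots of the edges p in B, whose coefficients are
   constant on the cosets of <B - p>; so (x_i - t_{w(i)}) f_w^B is a linear
   combination of coset splines f_v^{B - p}.  Hence the left span is stable
   under the x_i and contains the right span.

   Algebra.  A permutation lies in <B> iff it preserves the cuts of all edges
   outside B, so f_w^B is the product of f_w^E and of the linear coset splines
   f_w^{E - p} for p notin B. *)

(** * Fundamental cuts and edge groups *)

Section Cuts.

Variables (n : nat) (e : rel 'I_n).
Implicit Types (A B : {set 'I_n * 'I_n}) (p q : 'I_n * 'I_n) (u v : 'I_n).

Definition del_edge p : rel 'I_n :=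
  [rel x y | [&& e x y, (x, y) != p & (y, x) != p]].

(** Deleting [p] splits the tree in two; this is the side of [p.1] in the fundamental cut of [p]. *)
Definition cut p v := connect (del_edge p) p.1 v.

Lemma cut_fst p : cut p p.1.
Proof. exact: connect0. Qed.

Hypothesis tree_e : is_tree e.

Let e_sym : ssrbool.symmetric e. Proof. by case: tree_e => [[]]. Qed.

Lemma del_edge_sym p : ssrbool.symmetric (del_edge p).
Proof. by move=> x y; rewrite /del_edge /= e_sym; congr (_ && _); rewrite andbC. Qed.

Lemma edge_lt p : p \in edges e -> (p.1 < p.2)%N.
Proof. by rewrite inE => /andP[]. Qed.

Lemma edge_rel p : p \in edges e -> e p.1 p.2.
Proof. by rewrite inE => /andP[]. Qed.

(** A simple path from [p.1] to [p.2] avoiding [p] would close up with [p] into a cycle. *)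
Lemma cut_snd p : p \in edges e -> ~~ cut p p.2.
Proof.
move=> Ep; apply/negP => /connectP[s' path_s' last_s'].
case: tree_e => _ _ acyc.
case: (shortenP path_s') last_s' => s path_s uniq_s _ last_s.
have lt_p := edge_lt Ep.
apply: (acyc (p.1 :: s)).
  (* At least three vertices: an empty path would identify the ends of [p], and a single step would
     be the deleted edge [p]. *)
  case: s path_s {uniq_s} last_s => [|y [|z s]] //=.
    by move=> _ p21; rewrite p21 ltnn in lt_p.
  by rewrite andbT => /and3P[_ + _] y_p; rewrite -y_p -surjective_pairing eqxx.
rewrite /ucycle uniq_s andbT /= rcons_path -last_s.
rewrite e_sym (edge_rel Ep) andbT.
by apply: sub_path path_s => x y /and3P[].
Qed.

Lemma cut_edge p q :
  p \in edges e -> q \in edges e -> q != p -> cut p q.1 = cut p q.2.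
Proof.
move=> Ep Eq neq_qp.
apply: (same_connect_r (sym_connect_sym (@del_edge_sym p))).
apply: connect1; rewrite /del_edge /= (edge_rel Eq) -surjective_pairing neq_qp /=.
apply/eqP => q_p; have := edge_lt Eq.
by have := edge_lt Ep; rewrite -q_p /= => lt1 /(ltn_trans lt1); rewrite ltnn.
Qed.

Lemma cut_tperm p q v :
  p \in edges e -> q \in edges e -> q != p ->
  cut p (tperm q.1 q.2 v) = cut p v.
Proof. by move=> Ep Eq neq; case: tpermP => // ->; rewrite (cut_edge Ep Eq neq). Qed.

(** In a finite group, products of generators suffice, without inverses. Generators are prepended
    because [spline] compares [w] with [tperm i j * w]. *)
Lemma edge_group_ind B (P : 'S_n -> Prop) :
    P 1%g ->
    (forall p s, p \in B -> P s -> P (tperm p.1 p.2 * s)%g) ->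
  forall s, s \in edge_group B -> P s.
Proof.
move=> P1 PM s /gen_prodgP[k [c Bc ->]].
elim: k c Bc => [|k IHk] c Bc; first by rewrite big_ord0.
rewrite big_ord_recl; have /imsetP[p Bp ->] := Bc ord0.
by apply: PM => //; apply: IHk => i; apply: Bc.
Qed.

Lemma tperm_edge_group B p : p \in B -> tperm p.1 p.2 \in edge_group B.
Proof. by move=> Bp; apply/mem_gen/imsetP; exists p. Qed.

Lemma edge_groupS A B : A \subset B -> edge_group A \subset edge_group B.
Proof. by move=> sAB; apply/genS/imsetS. Qed.

Lemma cut_edge_group B p s v :
    B \subset edges e -> p \in edges e -> p \notin B -> s \in edge_group B ->
  cut p (s v) = cut p v.
Proof.
move=> sBE Ep nBp Gs.
move: s Gs v; apply: edge_group_ind => [v | q s Bq IHs v]; first by rewrite perm1.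
have Eq : q \in edges e by apply: subsetP Bq.
rewrite permM IHs cut_tperm //.
by apply: contraNneq nBp => <-.
Qed.

(** Only its own cut separates the ends of an edge, which gives the identity on edges; it then
    telescopes along a path from [u] to [v]. The difference of the two indicators is the sign with
    which [p] is crossed. *)
Lemma sub_edge_cut (V : zmodType) (h : 'I_n -> V) u v :
  h u - h v =
  \sum_(p in edges e) (h p.1 - h p.2) *+ cut p u
  - \sum_(p in edges e) (h p.1 - h p.2) *+ cut p v.
Proof.
have step p : p \in edges e ->
    h p.1 - h p.2 = \sum_(q in edges e) (h q.1 - h q.2) *+ cut q p.1
      - \sum_(q in edges e) (h q.1 - h q.2) *+ cut q p.2.
  move=> Ep; rewrite -sumrB (bigD1 p) //= cut_fst (negPf (cut_snd Ep)) subr0.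
  rewrite big1 ?addr0 // => q /andP[Eq neq].
  by rewrite (@cut_edge q p) ?subrr // eq_sym.
have edge_cases x y : e x y -> (x, y) \in edges e \/ (y, x) \in edges e.
  move=> exy; rewrite !inE /= exy e_sym exy !andbT.
  case: ltngtP => [_|_|/val_inj eq_xy]; [by left | by right |].
  by case: tree_e => [[_ irr]] _ _; rewrite eq_xy irr in exy.
case: tree_e => _ [_ /(_ u v)/connectP[s + ->]] _.
elim: s u => [|x s IHs] u /=; first by rewrite !subrr.
move=> /andP[eux /IHs IH].
rewrite -[h u](subrK (h x)) -addrA IH.
case: (edge_cases u x eux) => [/step /= ->|].
  by rewrite addrA subrK.
by move/step => /= H; rewrite -[h u - h x]opprB H opprB addrA subrK.
Qed.

(** Induction along the path: [tperm u w] is the conjugate of [tperm x w] by the first step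
    [tperm u x]. *)
Lemma tperm_connect_edge_group B (r : rel 'I_n) u v :
    (forall x y, r x y -> tperm x y \in edge_group B) ->
  connect r u v -> tperm u v \in edge_group B.
Proof.
move=> rB /connectP[s + ->]; elim: s u => [|x s IHs] u /=.
  by rewrite tperm1 group1.
move=> /andP[/rB Gux /IHs Gx]; set w := last x s in Gx *.
have [->|neq_uw] := eqVneq u w; first by rewrite tperm1 group1.
have [->//|neq_ux] := eqVneq u x; have [<-//|neq_xw] := eqVneq x w.
have -> : tperm u w = (tperm x w ^ tperm u x)%g.
  by rewrite tpermJ tpermR tpermD // eq_sym.
by rewrite groupJ.
Qed.

(** Induction on the number of moved points: composing [s] with [tperm u (s u)] fixes [u] and moves
    no new point. *)
Lemma tperm_orbits_group (G : {group 'S_n}) (s : 'S_n) :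
  (forall u, tperm u (s u) \in G) -> s \in G.
Proof.
have [m] := ubnP #|[set u | s u != u]|; elim: m s => // m IHm s le_s_m Gs.
have [s1 | [u neq_u]] := set_0Vmem [set u | s u != u].
  suff -> : s = 1%g by rewrite group1.
  apply/permP => u; rewrite perm1; apply/eqP/negPn.
  by have := in_set0 u; rewrite -s1 inE => ->.
rewrite inE in neq_u.
have -> : s = (s * tperm u (s u) * tperm u (s u))%g.
  by rewrite -mulgA tperm2 mulg1.
rewrite groupMr ?Gs //.
have tE x : (s * tperm u (s u))%g x = if x == u then u else
               if s x == u then s u else s x.
  rewrite permM; have [->|neq_x] := eqVneq x u; first by rewrite tpermR.
  have [->|neq_sx] := eqVneq (s x) u; first by rewrite tpermL.
  by rewrite tpermD // 1?eq_sym // (inj_eq perm_inj).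
apply: IHm => [|x].
  rewrite ltnS in le_s_m; apply: leq_trans le_s_m; apply: proper_card.
  apply/properP; split; last by exists u; rewrite !inE ?tE ?eqxx.
  apply/subsetP => x; rewrite !inE tE; have [->|neq_x] := eqVneq x u.
    by rewrite eqxx.
  by case: (s x =P u) => [->|_ //] _; rewrite eq_sym.
rewrite tE; case: ifP => [/eqP->|/negbT neq_x]; first by rewrite tperm1 group1.
case: ifP => // /eqP sx.
have [<-|neq_xsu] := eqVneq x (s u); first by rewrite tperm1 group1.
have -> : tperm x (s u) = (tperm x (s x) ^ tperm u (s u))%g.
  by rewrite sx tpermJ tpermL tpermD // eq_sym.
by rewrite groupJ.
Qed.

(* If s preserves every cut outside B, the indicator h of a component of
   (V, B) satisfies h u - h (s u) = 0 by sub_edge_cut, since h is constant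
   on the edges in B. *)
Lemma mem_edge_group B s : B \subset edges e ->
  (s \in edge_group B) =
  (s \in edge_group (edges e)) &&
    [forall p in edges e :\: B, s \in edge_group (edges e :\ p)].
Proof.
move=> sBE; apply/idP/andP => [Gs | [_ /forall_inP cuts]].
  split; first exact: subsetP (edge_groupS sBE) _ Gs.
  apply/forall_inP => p /setDP[Ep nBp]; apply: subsetP (edge_groupS _) _ Gs.
  by rewrite subsetD1 sBE.
pose r : rel 'I_n := [rel x y | ((x, y) \in B) || ((y, x) \in B)].
have r_sym : ssrbool.symmetric r by move=> x y; rewrite /r /= orbC.
apply: tperm_orbits_group => u.
apply: (@tperm_connect_edge_group _ r) => [x y /orP[] /tperm_edge_group //|].
  by rewrite tpermC.
pose h v : int := connect r u v.
have := sub_edge_cut h u (s u); rewrite -sumrB big1 => [|p Ep].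
  rewrite /h connect0; by case: connect.
have [Bp|nBp] := boolP (p \in B); last first.
  rewrite (@cut_edge_group (edges e :\ p) p s u) ?subrr ?subD1set ?setD11 //.
  by apply: cuts; rewrite inE nBp.
suff -> : h p.1 = h p.2 by rewrite subrr !mul0rn subr0.
rewrite /h (same_connect_r (sym_connect_sym r_sym) (y := p.2)) //.
by apply: connect1; rewrite /r /= -surjective_pairing Bp.
Qed.

End Cuts.

(** * Divisibility of polynomials by edge roots *)

Section Multiples.

Variable R : comNzRingType.
Implicit Types a f g : R.

Definition multiple a f := exists q, f = q * a.

Lemma multiple0 a : multiple a 0.
Proof. by exists 0; rewrite mul0r. Qed.

Lemma multipleD a f g : multiple a f -> multiple a g -> multiple a (f + g).
Proof. by move=> [q ->] [r ->]; exists (q + r); rewrite mulrDl. Qed.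

Lemma multipleB a f g : multiple a f -> multiple a g -> multiple a (f - g).
Proof. by move=> [q ->] [r ->]; exists (q - r); rewrite mulrBl. Qed.

Lemma multipleMl a f g : multiple a f -> multiple a (g * f).
Proof. by move=> [q ->]; exists (g * q); rewrite mulrA. Qed.

Lemma multipleMr a f g : multiple a f -> multiple a (f * g).
Proof. by rewrite mulrC; apply: multipleMl. Qed.

Lemma multiple_sub_mul a f f' g g' :
  multiple a (f - f') -> multiple a (g - g') -> multiple a (f * g - f' * g').
Proof.
move=> df dg; have -> : f * g - f' * g' = f * (g - g') + (f - f') * g'.
  by rewrite mulrBr mulrBl addrA subrK.
by apply: multipleD; [apply: multipleMl | apply: multipleMr].
Qed.

End Multiples.

Section MPoly.

Variables (K : fieldType) (n : nat).
Implicit Types (f g : {mpoly K[n]}) (p q : 'I_n * 'I_n) (v w : 'S_n).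

Lemma mpoly_alg_ind (P : {mpoly K[n]} -> Prop) :
    (forall c, P c%:MP) -> (forall f g, P f -> P g -> P (f + g)) ->
    (forall f g, P f -> P g -> P (f * g)) -> (forall i, P 'X_i) ->
  forall f, P f.
Proof.
move=> PC PD PM PX; elim/mpolyind => [|c m f _ _ Pf]; first by rewrite -mpolyC0.
apply: (PD) => //; rewrite -mul_mpolyC; apply: (PM) => //.
rewrite mpolyXE_id; apply: big_ind => [||i _]; [by rewrite -mpolyC1 | exact: PM |].
elim: (m i) => [|k IHk]; first by rewrite expr0 -mpolyC1.
by rewrite exprS; apply: PM.
Qed.

(** The polynomials on which [phi] and [psi] agree modulo [a] form a subalgebra, so the variables
    decide. *)
Lemma rmorph_sub_multiple (phi psi : {rmorphism {mpoly K[n]} -> {mpoly K[n]}}) a :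
    (forall c, phi c%:MP = psi c%:MP) ->
    (forall i, multiple a (phi 'X_i - psi 'X_i)) ->
  forall f, multiple a (phi f - psi f).
Proof.
move=> eqC dX; elim/mpoly_alg_ind => [c|f g df dg|f g df dg|//].
- by rewrite eqC subrr; apply: multiple0.
- by rewrite !rmorphD opprD addrACA; apply: multipleD.
- by rewrite !rmorphM; apply: multiple_sub_mul.
Qed.

Lemma msymC w (c : K) : msym w c%:MP_[n] = c%:MP.
Proof. by rewrite /msym mmapC. Qed.

Lemma msymXU w i : msym w 'X_i = 'X_(w i) :> {mpoly K[n]}.
Proof. by rewrite /msym mmapX mmap1U. Qed.

Definition edge_root p : {mpoly K[n]} := 'X_p.1 - 'X_p.2.

Lemma msym_edge_root w p : msym w (edge_root p) = 'X_(w p.1) - 'X_(w p.2).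
Proof. by rewrite /edge_root rmorphB /= !msymXU. Qed.

Lemma msym_tperm_edge_root p : msym (tperm p.1 p.2) (edge_root p) = - edge_root p.
Proof. by rewrite msym_edge_root tpermL tpermR opprB. Qed.

(** The two exchanged variables are equal modulo the root. *)
Lemma sub_msym_tperm_multiple p f :
  multiple (edge_root p) (f - msym (tperm p.1 p.2) f).
Proof.
apply: (@rmorph_sub_multiple idfun (msym (tperm p.1 p.2))) => [c|i] /=.
  by rewrite msymC.
rewrite msymXU; case: tpermP => [->|->|_ _]; last by rewrite subrr; apply: multiple0.
  by exists 1; rewrite mul1r.
by exists (-1); rewrite mulN1r opprB.
Qed.

Lemma edge_root_vertex_neq0 p : p.1 != p.2 -> edge_root p != 0.
Proof.
move=> neq; apply/eqP => /(congr1 (mcoeff U_(p.1)%MM)).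
rewrite mcoeffB !mcoeffXU eqxx eq_sym (negPf neq) mcoeff0 subr0.
by move/eqP; rewrite oner_eq0.
Qed.

End MPoly.

Arguments edge_root {K n}.

(** * Functions from permutations to polynomials *)

Section PolyFun.

Variables (K : fieldType) (n : nat).
Implicit Types (f : {mpoly K[n]}) (rho sigma : polyfun K n) (v w : 'S_n).
Implicit Types (P gen : polyfun K n -> Prop).

Lemma prod_polyfunE (I : Type) (r : seq I) (Q : pred I) (F : I -> polyfun K n) w :
  (\prod_(i <- r | Q i) F i) w = \prod_(i <- r | Q i) F i w.
Proof.
apply: (big_morph (fun rho : polyfun K n => rho w)) => [rho sigma|]; exact: ffunE.
Qed.

Lemma exp_polyfunE rho k w : (rho ^+ k) w = rho w ^+ k.
Proof. by elim: k => [|k IHk]; rewrite ?expr0 ?exprS !ffunE ?IHk. Qed.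

(** Operations on functions are pointwise, so evaluation can be done at each permutation in a
    commutative ring. *)
Lemma eval_atE (a : 'I_n -> polyfun K n) f w :
  eval_at a f w = mmap (@mpolyC n K) (fun i => a i w) f.
Proof.
rewrite /eval_at sum_ffunE; apply: eq_bigr => m _.
rewrite !ffunE mul_mpolyC prod_polyfunE; congr (_ *: _).
by apply: eq_bigr => i _; rewrite exp_polyfunE.
Qed.

Lemma left_actionE f rho w : left_action f rho w = f * rho w.
Proof.
rewrite !ffunE eval_atE; congr (_ * _).
rewrite [RHS](mpolyE f); apply: eq_bigr => m _.
rewrite mul_mpolyC mpolyXE_id; congr (_ *: _).
by apply: eq_bigr => i _; rewrite ffunE.
Qed.

Lemma right_actionE f rho w : right_action f rho w = msym w f * rho w.
Proof.
rewrite !ffunE eval_atE; congr (_ * _).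
apply: eq_bigr => m _; congr (_ * _).
by apply: eq_bigr => i _; rewrite ffunE.
Qed.

(** Turns right combinations with constant coefficients into left ones. *)
Lemma right_actionC (c : K) rho : right_action c%:MP rho = left_action c%:MP rho.
Proof. by apply/ffunP => w; rewrite right_actionE left_actionE msymC. Qed.

Lemma subalgebra_sum P (I : Type) (r : seq I) (Q : pred I) (F : I -> polyfun K n) :
  subalgebra P -> (forall i, Q i -> P (F i)) -> P (\sum_(i <- r | Q i) F i).
Proof.
case=> P1 PD _ PZ PF; apply: big_ind => //.
by rewrite -(scale0r (1 : polyfun K n)); apply: PZ.
Qed.

Lemma subalgebra_prod P (I : Type) (r : seq I) (Q : pred I) (F : I -> polyfun K n) :
  subalgebra P -> (forall i, Q i -> P (F i)) -> P (\prod_(i <- r | Q i) F i).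
Proof. by case=> P1 _ PM _ PF; apply: big_ind. Qed.

Lemma subalgebra_exp P rho k : subalgebra P -> P rho -> P (rho ^+ k).
Proof.
case=> P1 _ PM _ Prho; elim: k => [|k IHk]; first by rewrite expr0.
by rewrite exprS; apply: PM.
Qed.

Lemma subalgebra_eval_at P (a : 'I_n -> polyfun K n) f :
  subalgebra P -> (forall i, P (a i)) -> P (eval_at a f).
Proof.
move=> algP Pa; apply: subalgebra_sum => // m _; case: (algP) => _ _ _; apply.
by apply: subalgebra_prod => // i _; apply: subalgebra_exp.
Qed.

Lemma submodule_sum act P (I : Type) (r : seq I) (Q : pred I) (F : I -> polyfun K n) :
  submodule act P -> (forall i, Q i -> P (F i)) -> P (\sum_(i <- r | Q i) F i).
Proof. by case=> P0 PD _ PF; apply: big_ind. Qed.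

Lemma module_span_submodule act gen : submodule act (module_span act gen).
Proof.
split=> [P modP _|rho sigma Srho Ssigma P modP Pgen|f rho Srho P modP Pgen].
- by case: modP.
- by case: (modP) => _ PD _; apply: PD; [apply: Srho | apply: Ssigma].
- by case: (modP) => _ _; apply; apply: Srho.
Qed.

End PolyFun.

(** * Splines and coset splines *)

Section Splines.

Variables (K : fieldType) (n : nat) (e : rel 'I_n).
Implicit Types (B : {set 'I_n * 'I_n}) (p q : 'I_n * 'I_n) (v w : 'S_n).
Implicit Types (rho sigma : polyfun K n).

Lemma splineP rho :
  spline e rho <-> forall w p, p \in edges e ->
    multiple (msym w (edge_root p)) (rho w - rho (tperm p.1 p.2 * w)%g).
Proof.
split=> [spl w [i j] Ep | spl w i j Ep]; first by rewrite msym_edge_root; apply: spl.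
by have := spl w (i, j) Ep; rewrite msym_edge_root.
Qed.

Lemma subalgebra_spline : subalgebra (@spline K n e).
Proof.
split=> [|rho sigma|rho sigma|c rho]; rewrite !splineP.
- by move=> w p _; rewrite !ffunE subrr; apply: multiple0.
- move=> spl1 spl2 w p Ep; rewrite !ffunE opprD addrACA.
  by apply: multipleD; [apply: spl1 | apply: spl2].
- move=> spl1 spl2 w p Ep; rewrite !ffunE.
  by apply: multiple_sub_mul; [apply: spl1 | apply: spl2].
- move=> spl1 w p Ep; rewrite !ffunE -scalerBr -mul_mpolyC.
  exact/multipleMl/spl1.
Qed.

Lemma spline_spline_t i : spline e (spline_t K i).
Proof. by apply/splineP => w p _; rewrite !ffunE subrr; apply: multiple0. Qed.

Lemma spline_spline_x i : spline e (spline_x K i).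
Proof.
apply/splineP => w p _; rewrite !ffunE permM -!msymXU -rmorphB /=.
have [q] := sub_msym_tperm_multiple p ('X_i : {mpoly K[n]}).
rewrite msymXU => ->; rewrite rmorphM /=; exists (msym w q) => //.
Qed.

Lemma submodule_left_spline : submodule (@left_action K n) (spline e).
Proof.
have alg := subalgebra_spline; case: (alg) => _ splD splM splZ.
split=> // [|f rho spl].
  by rewrite -(scale0r (1 : polyfun K n)); apply: splZ; case: alg.
apply: (splM (eval_at _ f) rho) => //.
by apply: (subalgebra_eval_at f alg) => i; apply: spline_spline_t.
Qed.

Lemma submodule_right_spline : submodule (@right_action K n) (spline e).
Proof.
have alg := subalgebra_spline; case: (alg) => _ splD splM splZ.
split=> // [|f rho spl].
  by rewrite -(scale0r (1 : polyfun K n)); apply: splZ; case: alg.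
apply: (splM (eval_at _ f) rho) => //.
by apply: (subalgebra_eval_at f alg) => i; apply: spline_spline_x.
Qed.

Definition root_prod B : {mpoly K[n]} := \prod_(p in edges e :\: B) edge_root p.

(** On the support, the value at [v] is independent of [w], which only selects the coset. *)
Lemma coset_splineE B w v :
  coset_spline K e B w v =
  if (v * w^-1)%g \in edge_group B then msym v (root_prod B) else 0.
Proof.
rewrite !ffunE; case: ifP => _; last by rewrite rmorph0.
rewrite /root_prod !rmorph_prod; apply: eq_bigr => p _.
rewrite -[RHS]/(msym v (edge_root p)) msym_edge_root rmorphB /=.
by rewrite !msymXU !permM !permKV.
Qed.

(** The right action of [f] multiplies by [msym v f] at [v], so on each coset [k] enters as a single
    coefficient, its value at the representative. *)
Lemma coset_constant_sum B (k : 'S_n -> {mpoly K[n]}) :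
    (forall p w, p \in B -> k (tperm p.1 p.2 * w)%g = k w) ->
  [ffun w => msym w (k w * root_prod B)] =
  \sum_(C in rcosets (edge_group B) setT)
     right_action (k (repr C)) (coset_spline K e B (repr C)).
Proof.
move=> k_inv; set G := [group of edge_group B].
have kG s w : s \in G -> k (s * w)%g = k w.
  move=> Gs; move: s Gs w; apply: edge_group_ind => [w|p s Bp IHs w].
    by rewrite mul1g.
  by rewrite -mulgA k_inv.
apply/ffunP => v; rewrite sum_ffunE ffunE.
rewrite (bigD1 (G :* v)%g) /=; last by apply/rcosetsP; exists v; rewrite ?inE.
have Gr : (v * (repr (G :* v))^-1)%g \in G.
  by rewrite -mem_rcoset rcoset_repr rcoset_refl.
rewrite right_actionE coset_splineE Gr -rmorphM /=.
rewrite -[in LHS](kG _ _ (groupVr Gr)).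
rewrite invMg invgK mulgKV big1 ?addr0 // => C /andP[/rcosetsP[u _ ->] neq].
rewrite right_actionE coset_splineE; case: ifP => [Gu|_]; last by rewrite mulr0.
case/eqP: neq; apply/rcoset_eqP; rewrite rcoset_sym.
by rewrite -(rcoset_repr G u) mem_rcoset.
Qed.
End Splines.

(** * Spans of coset splines of a tree *)

Section TreeSplines.

Variables (K : fieldType) (n : nat) (e : rel 'I_n).
Hypothesis tree_e : is_tree e.
Implicit Types (B : {set 'I_n * 'I_n}) (p q : 'I_n * 'I_n) (v w : 'S_n).
Implicit Types (f g : {mpoly K[n]}) (rho sigma : polyfun K n).

(* The fundamental cut of p is dual to the roots: substituting along this
   tuple kills edge_root p and fixes the edge_root of every other edge. *)
Definition contraction p : n.-tuple {mpoly K[n]} :=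
  [tuple 'X_v - edge_root p *+ cut e p v | v < n].

Lemma contractX p (v : 'I_n) :
  'X_v \mPo contraction p = 'X_v - edge_root p *+ cut e p v.
Proof. by rewrite comp_mpolyXU -tnth_nth tnth_mktuple. Qed.

Lemma contract_edge_root p : p \in edges e -> edge_root p \mPo contraction p = 0.
Proof.
move=> Ep; rewrite rmorphB /= !contractX cut_fst (negPf (cut_snd tree_e Ep)) subr0.
by rewrite addrAC subrr.
Qed.

Lemma contract_edge_root_neq p q :
    p \in edges e -> q \in edges e -> q != p ->
  edge_root q \mPo contraction p = edge_root q.
Proof.
move=> Ep Eq neq; rewrite rmorphB /= !contractX (cut_edge tree_e Ep Eq neq).
by rewrite opprB addrA subrK.
Qed.

Lemma contract_multiple p f : multiple (edge_root p) (f - (f \mPo contraction p)).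
Proof.
apply: (@rmorph_sub_multiple _ _ idfun (comp_mpoly (contraction p))) => [c|v] /=.
  by rewrite comp_mpolyC.
rewrite contractX opprB addrC subrK; case: cut; last exact: multiple0.
by exists 1; rewrite mul1r.
Qed.

(** For [p] in [B] both arguments lie in the same coset or both outside, and the values differ by a
    swap; for [p] outside [B] the root of [p] divides each value. *)
Lemma coset_spline_spline B w :
  B \subset edges e -> spline e (coset_spline K e B w).
Proof.
move=> sBE; apply/splineP => v p Ep.
rewrite !coset_splineE -mulgA; have [Bp|nBp] := boolP (p \in B).
  rewrite (groupMl _ (tperm_edge_group Bp)).
  case: ifP => _; last by rewrite subrr; apply: multiple0.
  rewrite msymMm -rmorphB /=.
  have [q ->] := sub_msym_tperm_multiple p (root_prod K e B).
  by exists (msym v q); rewrite rmorphM.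
have [q ->] : multiple (edge_root p) (root_prod K e B).
  exists (\prod_(q in edges e :\: B | q != p) edge_root q).
  by rewrite mulrC /root_prod (bigD1 p) //= in_setD nBp.
rewrite msymMm !rmorphM /= msym_tperm_edge_root rmorphN /=.
apply: multipleB; case: ifP => _; rewrite ?mulrN -?mulNr;
  by [exact: multiple0 | eexists].
Qed.

Lemma edge_root_neq0 p : p \in edges e -> edge_root p != 0 :> {mpoly K[n]}.
Proof.
move/edge_lt => lt_p; apply: edge_root_vertex_neq0.
by rewrite -val_eqE neq_ltn lt_p.
Qed.

(** Invariant of the induction: [k] is already constant across the edges in [B], those in [s] are
    still to be treated, and the roots of all others have been factored out. Treating [p] moves it
    to [B] in one summand and to the factored roots in the other. *)
Lemma right_span_root_prod (s : seq ('I_n * 'I_n)) B (k : 'S_n -> {mpoly K[n]}) :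
    uniq s -> {subset s <= edges e} -> B \subset edges e ->
    {in s, forall p, p \notin B} ->
    (forall p w, p \in B -> k (tperm p.1 p.2 * w)%g = k w) ->
    {in s, forall p w, multiple (edge_root p) (k w - k (tperm p.1 p.2 * w)%g)} ->
  module_span (@right_action K n) (is_coset_spline e)
    [ffun w => msym w (k w * root_prod K e (B :|: [set p in s]))].
Proof.
have [_ spanD _] :=
  @module_span_submodule K n (@right_action K n) (is_coset_spline e).
elim: s B k => [|p s IHs] B k.
  move=> _ _ sBE _ k_inv _; rewrite (_ : [set p in [::]] = set0) ?setU0; last first.
    by apply/setP => p; rewrite !inE.
  rewrite coset_constant_sum //; apply: submodule_sum (module_span_submodule _ _) _.
  move=> C _ P modP Pgen; case: (modP) => _ _; apply; apply: Pgen.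
  by exists (repr C), B.
move=> /= /andP[nsp uniq_s] sE sBE nsB k_inv k_mul.
have Ep : p \in edges e by apply: sE; rewrite mem_head.
have nBp : p \notin B by apply: nsB; rewrite mem_head.
have {}sE : {subset s <= edges e} by move=> q sq; apply: sE; rewrite inE sq orbT.
have {}nsB : {in s, forall q, q \notin B}.
  by move=> q sq; apply: nsB; rewrite inE sq orbT.
have k_mul_p := k_mul p (mem_head _ _).
have {}k_mul :
    {in s, forall q w, multiple (edge_root q) (k w - k (tperm q.1 q.2 * w)%g)}.
  by move=> q sq; apply: k_mul; rewrite inE sq orbT.
have neq_sp q : q \in s -> q != p by apply: contraTneq => ->.
have nzp := edge_root_neq0 Ep.
pose pi f := f \mPo contraction p.
have /fin_all_exists[k' k'E] w : exists d, k w - pi (k w) = d * edge_root p.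
  exact: contract_multiple.
have -> : [ffun w => msym w (k w * root_prod K e (B :|: [set q in p :: s]))] =
    [ffun w => msym w (pi (k w) * root_prod K e (p |: B :|: [set q in s]))] +
    [ffun w => msym w (k' w * root_prod K e (B :|: [set q in s]))].
  have -> : B :|: [set q in p :: s] = p |: B :|: [set q in s].
    by apply/setP => q; rewrite !inE orbCA orbA.
  apply/ffunP => w; rewrite !ffunE -rmorphD /=; congr (msym w _).
  rewrite -[k w in LHS](subrK (pi (k w))) addrC mulrDl k'E -mulrA; congr (_ + _ * _).
  rewrite /root_prod [RHS](bigD1 p) /=; last first.
    by rewrite in_setD in_setU negb_or nBp inE nsp Ep.
  congr (_ * _); apply: eq_bigl => q.
  by rewrite !in_setD !in_setU in_set1 !negb_or -!andbA andbC -!andbA.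
apply: spanD; apply: IHs => //.
- by rewrite subUset sub1set Ep.
- by move=> q sq; rewrite !inE (negPf (neq_sp q sq)) nsB.
(* Applying [pi] to the congruence modulo the root of [p] turns it into an equality. *)
- move=> q w /setU1P[->|Bq]; last by rewrite k_inv.
  have [h] := k_mul_p w; move/(congr1 pi); rewrite /pi rmorphB rmorphM /=.
  by rewrite contract_edge_root // mulr0 => /eqP; rewrite subr_eq0 => /eqP.
(* [pi] fixes the root of [q], so the congruence for [q] survives. *)
- move=> q sq w; have [h kE] := k_mul q sq w; exists (pi h).
  rewrite /pi -rmorphB kE rmorphM /=.
  by rewrite (contract_edge_root_neq Ep (sE _ sq) (neq_sp _ sq)).
- by move=> q w Bq; apply: (mulIf nzp); rewrite -!k'E k_inv.
(* The difference of [k'] times the root of [p] is [h - pi h] times the root of [q]; since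
   [h - pi h] is a multiple of the root of [p], that root cancels. *)
move=> q sq w; have [h kE] := k_mul q sq w; have [d dE] := contract_multiple p h.
exists d; apply: (mulIf nzp); rewrite mulrBl -!k'E opprD addrACA -opprD.
rewrite kE /pi -rmorphB kE rmorphM /=.
rewrite (contract_edge_root_neq Ep (sE _ sq) (neq_sp _ sq)) -mulrBl dE.
by rewrite mulrAC.
Qed.

Lemma spline_right_span rho :
  spline e rho -> module_span (@right_action K n) (is_coset_spline e) rho.
Proof.
move=> /splineP spl; pose k w := msym w^-1 (rho w).
(* At the start [B] is empty and every edge is untreated, so the product of roots is 1. *)
have -> : rho =
    [ffun w => msym w (k w * root_prod K e (set0 :|: [set p in enum (edges e)]))].
  apply/ffunP => w; rewrite ffunE (_ : _ :|: _ = edges e).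
    by rewrite /root_prod setDv big_set0 mulr1 /k -msymMm mulVg msym1m.
  by apply/setP => p; rewrite !inE mem_enum inE.
apply: right_span_root_prod => [|p|||p w|p]; rewrite ?enum_uniq ?sub0set //.
- by rewrite mem_enum.
- by move=> p _; rewrite inE.
- by rewrite inE.
rewrite mem_enum => Ep w; have [q qE] := spl w p Ep.
(* Through [f], the difference splits into the transported spline condition and a swap of
   variables. *)
set f := msym w^-1 (rho (tperm p.1 p.2 * w)%g).
have -> : k (tperm p.1 p.2 * w)%g = msym (tperm p.1 p.2) f.
  by rewrite /k /f invMg tpermV msymMm.
rewrite -(subrK f (k w)) -addrA; apply: multipleD; last exact: sub_msym_tperm_multiple.
rewrite /k /f -rmorphB /= qE rmorphM /= -msymMm mulgV msym1m.
by exists (msym w^-1 q).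
Qed.

Lemma left_span_mul_spline_x_coset_spline i B w :
  B \subset edges e ->
  module_span (@left_action K n) (is_coset_spline e)
    (spline_x K i * coset_spline K e B w).
Proof.
move=> sBE.
have spanM := module_span_submodule (@left_action K n) (@is_coset_spline K n e).
have [_ spanD spanZ] := spanM.
pose G := [group of edge_group B].
(* These are the coefficients of [sub_edge_cut] between [i] and [v^-1 (w i)], for the function
   sending [u] to ['X_(v u)]; [k] cuts them off outside the coset of [w]. *)
pose c p v : K := (cut e p i)%:R - (cut e p (v^-1 (w i))%g)%:R.
pose k p v : {mpoly K[n]} := (c p v *+ ((v * w^-1)%g \in G))%:MP.
have root_prodD1 p :
    p \in B -> root_prod K e (B :\ p) = edge_root p * root_prod K e B.
  move=> Bp; rewrite /root_prod (bigD1 p) /=; last first.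
    by rewrite in_setD in_setD1 eqxx (subsetP sBE).
  congr (_ * _); apply: eq_bigl => q; rewrite !in_setD in_set1 andbC.
  by have [->|_] := eqVneq q p; rewrite ?Bp.
have -> : spline_x K i * coset_spline K e B w =
    left_action 'X_(w i) (coset_spline K e B w)
    + \sum_(p in B) [ffun v => msym v (k p v * root_prod K e (B :\ p))].
  apply/ffunP => v; rewrite [RHS]ffunE left_actionE sum_ffunE.
  rewrite [LHS]ffunE [spline_x _ _ _]ffunE coset_splineE.
  case: ifP => [Gv|nGv]; last first.
    rewrite !mulr0 add0r big1 // => p _.
    by rewrite ffunE /k nGv mulr0n mul0r rmorph0.
  have -> : \sum_(p in B) [ffun v => msym v (k p v * root_prod K e (B :\ p))] v =
      (\sum_(p in B) (c p v)%:MP * msym v (edge_root p)) * msym v (root_prod K e B).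
    rewrite mulr_suml; apply: eq_bigr => p Bp.
    by rewrite ffunE /k Gv mulr1n root_prodD1 // mulrA !rmorphM /= msymC.
  rewrite -mulrDl; congr (_ * _); apply/eqP; rewrite addrC -subr_eq; apply/eqP.
  have := sub_edge_cut tree_e (fun u => 'X_(v u) : {mpoly K[n]}) i (v^-1 (w i))%g.
  rewrite permKV => ->; rewrite -sumrB (big_setID B) /= [X in _ + X]big1 ?addr0.
    rewrite (setIidPr sBE); apply: eq_bigr => p _.
    by rewrite /c mpolyCB !mpolyC_nat mulrBl !mulr_natl msym_edge_root.
  (* An edge outside [B] contributes nothing: the permutation taking [i] to [v^-1 (w i)] preserves
     its cut. *)
  move=> p /setDP[Ep nBp].
  have Gv' : (w * v^-1)%g \in edge_group B by rewrite -groupV invMg invgK.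
  have := cut_edge_group tree_e i sBE Ep nBp Gv'.
  by rewrite permM => ->; rewrite subrr.
apply: spanD.
  by apply: spanZ => P _; apply; exists w, B.
apply: submodule_sum (spanM) _ => p Bp; rewrite coset_constant_sum => [|q v Bq].
  apply: submodule_sum (spanM) _ => C _; rewrite right_actionC.
  apply: spanZ => P _; apply; exists (repr C), (B :\ p); split=> //.
  exact: subset_trans (subD1set _ _) sBE.
(* Swapping along [q] preserves both the coset and, as [q] differs from [p], the cut of [p]. *)
have [neq_qp Bq'] := setD1P Bq.
rewrite /k -mulgA (groupMl _ (tperm_edge_group Bq')) /c invMg tpermV permM.
by rewrite cut_tperm ?(subsetP sBE).
Qed.

Lemma spline_left_span rho :
  spline e rho -> module_span (@left_action K n) (is_coset_spline e) rho.
Proof.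
set S := module_span _ _.
have spanM : submodule (@left_action K n) S by apply: module_span_submodule.
have [span0 spanD spanZ] := spanM.
have xS i sigma : S sigma -> S (spline_x K i * sigma).
  (* The elements that [spline_x K i] multiplies into [S] form a left submodule, so only coset
     splines need checking. *)
  move=> Ssigma; apply: (Ssigma (fun s => S (spline_x K i * s)));
    [split|] => [|s t Ss St|f s Ss|s [w [B [sBE ->]]]].
  - by rewrite mulr0.
  - by rewrite mulrDr; apply: spanD.
  - have -> : spline_x K i * left_action f s = left_action f (spline_x K i * s).
      by apply/ffunP => w; rewrite ffunE !left_actionE [in RHS]ffunE mulrCA.
    exact: spanZ.
  - exact: left_span_mul_spline_x_coset_spline.
(* The multipliers preserving [S] form a subalgebra; containing each [spline_x K i], it makes [S] a
   right submodule. *)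
have algS : subalgebra (fun sigma => forall tau, S tau -> S (sigma * tau)).
  split=> [tau|s t Ss St tau|s t Ss St tau|a s Ss tau] Stau.
  - by rewrite mul1r.
  - by rewrite mulrDl; apply: spanD; [apply: Ss | apply: St].
  - by rewrite -mulrA; apply: (Ss); apply: (St).
  - have -> : (a *: s) * tau = left_action a%:MP (s * tau).
      by apply/ffunP => w; rewrite left_actionE !ffunE mul_mpolyC scalerAl.
    by apply: spanZ; apply: (Ss).
move=> /spline_right_span/(_ S); apply; last by move=> s gen_s P _; apply.
split; [exact: span0 | exact: spanD |] => f s Ss.
have xS' i : (fun sigma => forall tau, S tau -> S (sigma * tau)) (spline_x K i).
  by move=> tau; apply: xS.
by have /(_ s Ss) := subalgebra_eval_at f algS xS'.
Qed.

Lemma coset_spline_prod B w : B \subset edges e ->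
  coset_spline K e B w = coset_spline K e (edges e) w *
    \prod_(p in edges e :\: B) coset_spline K e (edges e :\ p) w.
Proof.
move=> sBE; apply/ffunP => v; rewrite [RHS]ffunE prod_polyfunE !coset_splineE.
rewrite (mem_edge_group tree_e) //; case: ifP => [/andP[-> /forall_inP Gv]|].
  rewrite {2}/root_prod setDv big_set0 rmorph1 mul1r /root_prod rmorph_prod.
  apply: eq_bigr => p EBp; rewrite coset_splineE Gv // /root_prod.
  have /setDP[Ep _] := EBp.
  rewrite (_ : edges e :\: (edges e :\ p) = [set p]) ?big_set1 //.
  by rewrite setDDr setDv set0U; apply/setIidPr; rewrite sub1set.
(* Off the support, either the factor of [edges e] vanishes or some cut is violated and its linear
   factor vanishes. *)
case: (_ \in edge_group (edges e)) => /= [/forall_inPn[p EBp nGv]|_];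
  last by rewrite mul0r.
by rewrite [X in _ * X](bigD1 p) //= coset_splineE (negPf nGv) mul0r mulr0.
Qed.

Lemma constant_or_linear_edges w :
  constant_or_linear_coset_spline e (coset_spline K e (edges e) w).
Proof.
split; first by exists w, (edges e).
left=> v; rewrite coset_splineE /root_prod setDv big_set0 rmorph1.
by case: ifP => _; [apply: dhomog1 | apply: dhomog0].
Qed.

Lemma constant_or_linear_edges_D1 p w : p \in edges e ->
  constant_or_linear_coset_spline e (coset_spline K e (edges e :\ p) w).
Proof.
move=> Ep; split; first by exists w, (edges e :\ p); rewrite subD1set.
right=> v; rewrite coset_splineE; case: ifP => _; last exact: dhomog0.
rewrite /root_prod (_ : edges e :\: (edges e :\ p) = [set p]) ?big_set1; last first.
  by rewrite setDDr setDv set0U; apply/setIidPr; rewrite sub1set.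
rewrite msym_edge_root; by apply: rpredB; rewrite dhomogX; apply/eqP/mdeg1.
Qed.

Lemma subalgebra_coset_spline (P : polyfun K n -> Prop) B w :
    subalgebra P ->
    (forall sigma, constant_or_linear_coset_spline e sigma -> P sigma) ->
  B \subset edges e -> P (coset_spline K e B w).
Proof.
move=> algP Pgen sBE; rewrite coset_spline_prod //; case: (algP) => _ _ PM _.
apply: PM; first exact/Pgen/constant_or_linear_edges.
apply: subalgebra_prod => // p /setDP[Ep _].
exact/Pgen/constant_or_linear_edges_D1.
Qed.

Lemma spline_module_spanE act rho :
    submodule act (@spline K n e) ->
    (spline e rho -> module_span act (is_coset_spline e) rho) ->
  spline e rho <-> module_span act (is_coset_spline e) rho.
Proof.
move=> modS spanS; split=> // /(_ (spline e)); apply=> // sigma [w [B [sBE ->]]].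
exact: coset_spline_spline.
Qed.

(** A subalgebra containing these generators contains all coset splines and is stable under
    multiplication by polynomials in the [a i], so the module span lies inside it. *)
Lemma spline_algebra_spanE (a : 'I_n -> polyfun K n) rho :
    (forall i, spline e (a i)) ->
    (spline e rho ->
     module_span (fun f sigma => eval_at a f * sigma) (is_coset_spline e) rho) ->
  spline e rho <->
  algebra_span (fun sigma => constant_or_linear_coset_spline e sigma \/
                             exists i, sigma = a i) rho.
Proof.
move=> spl_a span_rho; split=> [spl P algP Pgen | /(_ (spline e))]; last first.
  apply=> [|sigma [[[w [B [sBE ->]]] _]|[i ->]] //]; first exact: subalgebra_spline.
  exact: coset_spline_spline.
apply: (span_rho spl P) => [|sigma [w [B [sBE ->]]]]; last first.
  by apply: subalgebra_coset_spline => // tau gen_tau; apply: Pgen; left.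
case: (algP) => _ PD PM PZ; split=> // [|f sigma Psigma].
  by rewrite -(scale0r (1 : polyfun K n)); apply: PZ; case: algP.
apply: (PM (eval_at a f) sigma) => //; apply: (subalgebra_eval_at f algP) => i.
by apply: Pgen; right; exists i.
Qed.

End TreeSplines.

Theorem theoremB (R : realType) (n : nat) (e : rel 'I_n) (tree_e : is_tree e) :
  [/\ forall rho : polyfun R[i] n,
        spline e rho <->
        module_span (@left_action R[i] n) (is_coset_spline e) rho,
      forall rho : polyfun R[i] n,
        spline e rho <->
        module_span (@right_action R[i] n) (is_coset_spline e) rho,
      forall rho : polyfun R[i] n,
        spline e rho <->
        algebra_span (fun sigma => constant_or_linear_coset_spline e sigma \/
                                   exists i : 'I_n, sigma = spline_t R[i] i) rho
    & forall rho : polyfun R[i] n,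
        spline e rho <->
        algebra_span (fun sigma => constant_or_linear_coset_spline e sigma \/
                                   exists i : 'I_n, sigma = spline_x R[i] i) rho].
Proof.
split=> rho.
- apply: spline_module_spanE => //; first exact: submodule_left_spline.
  exact: spline_left_span.
- apply: spline_module_spanE => //; first exact: submodule_right_spline.
  exact: spline_right_span.
- apply: spline_algebra_spanE => //; first exact: spline_spline_t.
  exact: spline_left_span.
- apply: spline_algebra_spanE => //; first exact: spline_spline_x.
  exact: spline_right_span.
Qed.
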